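(* Suppose $p\neq2$ and let $\alpha,\beta,\gamma\in\widehat{\mathbb{F}_q^\times}$ with $\beta^2\neq\varepsilon$. Then for $x\in\mathbb{F}_q$ and $y\in\mathbb{F}_q\setminus\{\pm1\}$, $$F_4\!\left({\alpha;\alpha\overline{\beta}\phi\atop\gamma,\beta\phi};x,y^2\right)=\overline{\alpha}^2(1+y)\,F_2\!\left({\alpha;\alpha\overline{\beta}\phi,\beta\atop\gamma,\beta^2};\frac{x}{(1+y)^2},\frac{4y}{(1+y)^2}\right).$$
   Context: $\mathbb{F}_q$ is a finite field with $q$ elements and characteristic $p$. $\widehat{\mathbb{F}_q^\times}$ is the group of multiplicative characters $\mathbb{F}_q^\times\to\overline{\mathbb{Q}}^\times$, $\varepsilon$ the trivial character, $\phi$ the quadratic character; every character (including $\varepsilon$) is extended by $0$ at $0$; $\overline{\eta}=\eta^{-1}$; $\delta(\eta)=1$ if $\eta=\varepsilon$, else $0$. $\psi$ is a fixed non-trivial additive character. $g(\eta)=-\sum_{x\in\mathbb{F}_q^\times}\psi(x)\eta(x)$, $g^\circ(\eta)=q^{\delta(\eta)}g(\eta)$, $(\alpha)_\nu=g(\alpha\nu)/g(\alpha)$, $(\alpha)^\circ_\nu=g^\circ(\alpha\nu)/g^\circ(\alpha)$. Appell's functions: for $x,y\in\mathbb{F}_q$, with sums over $\nu_1,\nu_2\in\widehat{\mathbb{F}_q^\times}$, $F_2\!\left({\alpha;\beta_1,\beta_2\atop\gamma_1,\gamma_2};x,y\right)=\frac{1}{(1-q)^2}\sum\frac{(\alpha)_{\nu_1\nu_2}(\beta_1)_{\nu_1}(\beta_2)_{\nu_2}}{(\gamma_1)^\circ_{\nu_1}(\gamma_2)^\circ_{\nu_2}(\varepsilon)^\circ_{\nu_1}(\varepsilon)^\circ_{\nu_2}}\nu_1(x)\nu_2(y)$,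 $F_4\!\left({\alpha;\beta\atop\gamma_1,\gamma_2};x,y\right)=\frac{1}{(1-q)^2}\sum\frac{(\alpha)_{\nu_1\nu_2}(\beta)_{\nu_1\nu_2}}{(\gamma_1)^\circ_{\nu_1}(\gamma_2)^\circ_{\nu_2}(\varepsilon)^\circ_{\nu_1}(\varepsilon)^\circ_{\nu_2}}\nu_1(x)\nu_2(y)$. *)

(* Defs.v *)
From HB Require Import structures.
From mathcomp Require Import all_boot all_order all_algebra all_fingroup all_solvable all_field all_character.
Set Implicit Arguments.
Unset Strict Implicit.
Unset Printing Implicit Defensive.
Import GRing.Theory Num.Theory.
Local Open Scope ring_scope.

(* Multiplicative characters of F_q^x are the (linear) irreducible characters
   of the abelian group of units of F, with values in algC, extended by 0 at 0.
   All character-valued objects below are handled as functions F -> algC. *)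

Section FF.
Variable F : finFieldType.

Definition UG := [set: {unit F}]%G.

Definition mchar (i : Iirr UG) (x : F) : algC :=
  if insub x is Some u then 'chi[UG]_i u else 0.

Definition eps (x : F) : algC := if x != 0 then 1 else 0.

Definition qchar (x : F) : algC :=
  if x == 0 then 0 else if [exists z : F, z ^+ 2 == x] then 1 else -1.

Definition fmul (f h : F -> algC) : F -> algC := fun x => f x * h x.
Definition fconj (f : F -> algC) : F -> algC := fun x => (f x)^-1.

Definition delta (eta : F -> algC) : nat := [forall x, eta x == eps x].

Definition additive_char (psi : F -> algC) : Prop :=
  (forall x y, psi (x + y) = psi x * psi y) /\ exists x, psi x != 1.

Definition gauss (psi eta : F -> algC) : algC :=
  - \sum_(x : F | x != 0) psi x * eta x.

Definition gaussc (psi eta : F -> algC) : algC :=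
  (#|F|%:R) ^+ delta eta * gauss psi eta.

Definition poch (psi a nu : F -> algC) : algC :=
  gauss psi (fmul a nu) / gauss psi a.

Definition pochc (psi a nu : F -> algC) : algC :=
  gaussc psi (fmul a nu) / gaussc psi a.

Definition appellF2 (psi a b1 b2 c1 c2 : F -> algC) (x y : F) : algC :=
  (1 - #|F|%:R)^-2 * \sum_(i : Iirr UG) \sum_(j : Iirr UG)
    let n1 := mchar i in let n2 := mchar j in
    poch psi a (fmul n1 n2) * poch psi b1 n1 * poch psi b2 n2
    / (pochc psi c1 n1 * pochc psi c2 n2 * pochc psi eps n1 * pochc psi eps n2)
    * n1 x * n2 y.

Definition appellF4 (psi a b c1 c2 : F -> algC) (x y : F) : algC :=
  (1 - #|F|%:R)^-2 * \sum_(i : Iirr UG) \sum_(j : Iirr UG)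
    let n1 := mchar i in let n2 := mchar j in
    poch psi a (fmul n1 n2) * poch psi b (fmul n1 n2)
    / (pochc psi c1 n1 * pochc psi c2 n2 * pochc psi eps n1 * pochc psi eps n2)
    * n1 x * n2 y.

End FF.

(* Main.v *)
(* Comparing the coefficients of [nu_1 x] reduces the identity to a quadratic
   transformation of 2F1: with C = B^-1 phi,
     2F1(A, A C; C^-1; y^2) = A^-2(1 + y) 2F1(A, B; B^2; 4y / (1 + y)^2).
   As functions of A, both sides are Mellin transforms.  Writing K for the
   Kloosterman sum K(w) = sum_t C(t) psi(t + w / t), the left side is the
   transform of w |-> K(w) K(w y^2) and the right side, after the substitution
   t = (1 + u) / 2 in its Jacobi-type integral, that of
   w |-> sum_u B(1 - u^2) K(w (1 + 2 u y + y^2)).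
   These agree up to a constant by a finite Gegenbauer product formula, which
   follows from an elementary change of variables in K(w) K(w y^2) (where
   y <> 1, -1 is used) and from the Poisson-type integral
   sum_u B(1 - u^2) psi(2 u z) = l K(z^2), a quadratic Gauss sum computation.
   The case z = 0 of the latter identifies the constant, so the duplication
   formula for Gauss sums is not needed. *)
Require Import Defs.
From HB Require Import structures.
From mathcomp Require Import all_boot all_order all_algebra all_fingroup all_solvable all_field all_character.
From mathcomp Require Import ring.
From Stdlib Require Import FunctionalExtensionality.
Set Implicit Arguments.
Unset Strict Implicit.
Unset Printing Implicit Defensive.
Import GRing.Theory Num.Theory.
Local Open Scope ring_scope.

(** * Multiplicative characters: orthogonality and the quadratic character *)

Section MultiplicativeCharacters.
Variable F : finFieldType.
Implicit Types (f h : F -> algC) (x y k : F).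
Local Notation q := (#|F|%:R : algC).

(** Products, inverses and [qchar] are not literally of the form [mchar i]; this predicate treats
    them all alike, extension by zero included. *)
Definition is_mchar f := [/\ f 0 = 0, f 1 = 1 & {morph f : x y / x * y}].

Lemma is_mchar_neq0 f x : is_mchar f -> x != 0 -> f x != 0.
Proof.
move=> [_ f1 fM] x0; apply: contra_eq_neq f1 => fx0.
by rewrite -(divff x0) fM fx0 mul0r eq_sym oner_eq0.
Qed.

Lemma is_mcharV f x : is_mchar f -> f x^-1 = (f x)^-1.
Proof.
move=> fP; have [f0 f1 fM] := fP.
have [->|x0] := eqVneq x 0; first by rewrite invr0 f0 invr0.
apply: (mulfI (is_mchar_neq0 fP x0)).
by rewrite -fM !divff // is_mchar_neq0.
Qed.

Lemma is_mchar_eps : is_mchar (@eps F).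
Proof.
split; rewrite /eps ?eqxx ?oner_eq0 // => x y.
by rewrite mulf_eq0 negb_or; case: (x == 0); case: (y == 0); rewrite /= ?mulr0 ?mulr1.
Qed.

Lemma is_mchar_fmul f h : is_mchar f -> is_mchar h -> is_mchar (fmul f h).
Proof.
move=> [f0 f1 fM] [h0 h1 hM]; split; rewrite /fmul ?f0 ?f1 ?h1 ?mul0r ?mulr1 //.
by move=> x y; rewrite fM hM mulrACA.
Qed.

Lemma is_mchar_fconj f : is_mchar f -> is_mchar (fconj f).
Proof.
move=> [f0 f1 fM]; split; rewrite /fconj ?f0 ?f1 ?invr0 ?invr1 //.
by move=> x y; rewrite fM invfM.
Qed.

Lemma irr_unit_lin (i : Iirr (UG F)) : 'chi_i \is a linear_char.
Proof. by move: i; apply/char_abelianP/cyclic_abelian/field_unit_group_cyclic. Qed.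

Lemma is_mchar_mchar i : is_mchar (mchar (F:=F) i).
Proof.
have mcharE (u : {unit F}) : mchar i (val u) = 'chi_i u.
  by rewrite /mchar valK.
have mchar0 : mchar i 0 = 0 by rewrite /mchar insubF // unitr0.
split => //; first by rewrite -(lin_char1 (irr_unit_lin i)) -mcharE.
move=> x y.
have [->|x0] := eqVneq x 0; first by rewrite mul0r mchar0 mul0r.
have [->|y0] := eqVneq y 0; first by rewrite mulr0 mchar0 mulr0.
have ux : x \is a GRing.unit by rewrite unitfE.
have uy : y \is a GRing.unit by rewrite unitfE.
pose u : {unit F} := Sub x ux; pose v : {unit F} := Sub y uy.
have -> : x = val u by []. have -> : y = val v by [].
by rewrite -FinRing.val_unitM !mcharE lin_charM ?irr_unit_lin ?inE.
Qed.

(** Second orthogonality: all irreducible characters are linear, so their plain sum is the regular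
    character, which is supported at the identity. *)
Lemma sum_mchar x :
  \sum_(i : Iirr (UG F)) mchar i x = (q - 1) * (x == 1)%:R.
Proof.
have [->|x0] := eqVneq x 0.
  rewrite eq_sym oner_eq0 mulr0 big1 // => i _.
  by have [] := is_mchar_mchar i.
have ux : x \is a GRing.unit by rewrite unitfE.
pose u : {unit F} := Sub x ux.
have := cfRegE (UG F) u; rewrite cfReg_sum sum_cfunE => E.
have -> : \sum_(i : Iirr (UG F)) mchar i x = \sum_i ('chi_i 1%g *: 'chi[UG F]_i) u.
  apply: eq_bigr => i _; rewrite cfunE lin_char1 ?irr_unit_lin // mul1r.
  by rewrite /mchar (_ : x = val u) // valK.
rewrite E -val_eqE card_finField_unit mulr_natr /= -subn1 natrB //.
by apply/card_gt0P; exists 0.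
Qed.

Lemma sum_scale (G : F -> algC) k : k != 0 -> \sum_x G (k * x) = \sum_x G x.
Proof. by move=> k0; rewrite [RHS](reindex_inj (mulfI k0)). Qed.

Lemma sum_translate (G : F -> algC) k : \sum_x G (x + k) = \sum_x G x.
Proof. by rewrite [RHS](reindex_inj (addIr k)). Qed.

Lemma sum_inv (G : F -> algC) : \sum_x G x^-1 = \sum_x G x.
Proof. by rewrite [RHS](reindex_inj invr_inj). Qed.

Lemma sum_neq0 (G : F -> algC) : \sum_(x | x != 0) G x = \sum_x G x - G 0.
Proof. by rewrite [X in _ = X - _](bigD1 0) //= [G 0 + _]addrC addrK. Qed.

Lemma eps_neq0 x : x != 0 -> eps x = 1.
Proof. by rewrite /eps => ->. Qed.

Lemma fmul_eps f : is_mchar f -> fmul f (@eps F) = f.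
Proof.
move=> [f0 _ _]; apply: functional_extensionality => x.
rewrite /fmul /eps; have [->|] := eqVneq x 0; by rewrite ?f0 ?mulr0 ?mulr1.
Qed.

Lemma eps_fmul f : is_mchar f -> fmul (@eps F) f = f.
Proof.
move=> fP; rewrite -[RHS](fmul_eps fP).
by apply: functional_extensionality => x; rewrite /fmul mulrC.
Qed.

Lemma deltaP f : reflect (f = @eps F) (delta f == 1%N).
Proof.
rewrite /delta eqb1; apply: (iffP forallP) => [fE|-> x //].
by apply: functional_extensionality => x; apply/eqP.
Qed.

Lemma delta_neq f : f <> @eps F -> delta f = 0%N.
Proof. by move/deltaP; rewrite /delta eqb1 => /negPf->. Qed.

Lemma delta_eps : delta (@eps F) = 1%N.
Proof. by apply/eqP/deltaP. Qed.

(** If [f y] is not 1 for some unit [y], the substitution [x -> y * x] multiplies the sum by [f y],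
    so the sum is zero. *)
Lemma sum_is_mchar f : is_mchar f -> \sum_x f x = (q - 1) * (delta f)%:R.
Proof.
move=> fP; have [f0 f1 fM] := fP.
have [/eqP dE|] := boolP (delta f == 1%N).
  rewrite dE mulr1; have /eqP/deltaP -> := dE.
  have -> : \sum_(x : F) eps x = \sum_(x : F | x != 0) (1 : algC).
    by rewrite /eps -big_mkcond.
  by rewrite sum_neq0 sumr_const.
move/deltaP => fne; rewrite (delta_neq fne) mulr0.
have [/existsP[y /andP[y0 fy]]|/existsPn H] :=
    boolP [exists y, (y != 0) && (f y != 1)]; last first.
  case: fne; apply: functional_extensionality => x; rewrite /eps.
  have [->|x0] := eqVneq x 0; first by rewrite f0.
  by apply/eqP; have := H x; rewrite x0 negbK.
have E : f y * \sum_x f x = \sum_x f x.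
  by rewrite mulr_sumr -[RHS](sum_scale f y0); apply: eq_bigr => x _; rewrite fM.
have /eqP : (f y - 1) * \sum_x f x = 0 by rewrite mulrBl E mul1r subrr.
by rewrite mulf_eq0 subr_eq0 (negPf fy) => /eqP.
Qed.

Section OddCharacteristic.
Hypothesis char_neq2 : ~~ (2%N \in [pchar F]).

Lemma two_neq0 : 2%:R != 0 :> F.
Proof. by apply: contra char_neq2 => E; rewrite inE. Qed.

Lemma qchar_sqr x : x != 0 -> qchar (x ^+ 2) = 1.
Proof.
move=> x0; rewrite /qchar expf_eq0 /= (negPf x0).
by case: existsP => // -[]; exists x.
Qed.

(** On a generator [g] of the unit group [qchar (g ^ n) = (-1) ^ n]. The parity of [n] depends on
    the power only, because the order of [g] is even. *)
Lemma is_mchar_qchar : is_mchar (@qchar F).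
Proof.
split; first by rewrite /qchar eqxx.
  by rewrite -(expr1n _ 2) qchar_sqr ?oner_eq0.
have /cyclicP[g gE] := field_unit_group_cyclic (UG F).
(* The order of [g] is that of the unit group and so kills [-1]; if it were odd, [-1 = 1] would
   follow. *)
have even_g : ~~ odd #[g]%g.
  apply/negP => og; have u : (-1 : F) \is a GRing.unit by rewrite unitrN1.
  have : ((Sub (-1) u : {unit F}) ^+ #[g])%g = 1%g.
    rewrite -(_ : #|UG F| = #[g]%g); last by rewrite /order -gE.
    by rewrite expg_cardG ?inE.
  move/(congr1 val); rewrite FinRing.val_unitX /= -signr_odd og expr1.
  by move/eqP; rewrite eq_sym -addr_eq0 (negPf two_neq0).
have powE x : x != 0 -> exists n, x = val g ^+ n.
  rewrite -unitfE => ux; have : (Sub x ux : {unit F}) \in UG F by rewrite inE.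
  by rewrite gE => /cycleP[n nE]; exists n; rewrite -FinRing.val_unitX -nE.
have g0 : val g != 0 by rewrite -unitfE (valP g).
have qE n : qchar (val g ^+ n) = (-1) ^+ n.
  rewrite /qchar expf_eq0 (negPf g0) andbF -signr_odd.
  case: existsP => [[z /eqP zE]|H]; last first.
    case: (boolP (odd n)) => // /even_halfK nE; case: H; exists (val g ^+ n./2).
    by rewrite -exprM muln2 nE.
  have z0 : z != 0 by move/eqP: zE; apply: contraTneq => ->;
    rewrite expr0n /= eq_sym expf_eq0 (negPf g0) andbF.
  have [j zj] := powE z z0; move: zE; rewrite zj -exprM -!FinRing.val_unitX => /val_inj/eqP.
  rewrite eq_expg_mod_order => /eqP/(congr1 odd).
  have oddmod m : odd (m %% #[g]%g) = odd m.
    by rewrite [in RHS](divn_eq m #[g]%g) oddD oddM (negPf even_g) andbF.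
  by rewrite !oddmod oddM andbF => <-.
move=> x y.
have [->|/powE[k ->]] := eqVneq x 0; first by rewrite mul0r {1 2}/qchar eqxx mul0r.
have [->|/powE[l ->]] := eqVneq y 0; first by rewrite mulr0 {1 3}/qchar eqxx mulr0.
by rewrite -exprD !qE exprD.
Qed.

(** The number of square roots of [v] is [1 + qchar v], also at [v = 0]. *)
Lemma sum_sqr (G : F -> algC) : \sum_x G (x ^+ 2) = \sum_x (1 + qchar x) * G x.
Proof.
rewrite (partition_big (fun x => x ^+ 2) predT) //=; apply: eq_bigr => v _.
transitivity (\sum_(x in [pred x | x ^+ 2 == v]) G v).
  by apply: eq_big => x; rewrite ?inE // => /eqP->.
rewrite sumr_const -[LHS]mulr_natl; congr (_ * _).
rewrite /qchar; have [->|v0] := eqVneq v 0.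
  rewrite addr0 -[RHS]/(1%:R); congr _%:R; rewrite -(card1 (0 : F)); apply: eq_card => x.
  by rewrite !inE expf_eq0.
case: existsP => [[z /eqP zE]|H].
  have z0 : z != 0 by apply: contra v0 => /eqP z0; rewrite -zE z0 expr0n.
  rewrite -[1 + 1]/(2%:R); congr _%:R.
  transitivity #|pred2 z (- z)|.
    by apply: eq_card => x; rewrite !inE -zE eqf_sqr.
  rewrite card2; have -> // : z != - z.
  by rewrite -addr_eq0 -mulr2n -mulr_natl mulf_eq0 negb_or two_neq0.
rewrite subrr -[RHS]/(0%:R); congr _%:R; apply: eq_card0 => x; rewrite !inE.
by apply/negP => E; case: H; exists x.
Qed.

End OddCharacteristic.
End MultiplicativeCharacters.

(** * Gauss sums: reflection formula and Jacobi sums *)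

Section GaussSums.
Variables (F : finFieldType) (psi : F -> algC).
Hypothesis psiD : {morph psi : x y / x + y >-> x * y}.
Hypothesis psi0 : psi 0 = 1.
Hypothesis psi_neq1 : exists x, psi x != 1.
Implicit Types (f h A B C X : F -> algC) (x y z w k r s t u : F).
Local Notation q := (#|F|%:R : algC).
Local Notation g := (gauss psi).
Local Notation gc := (gaussc psi).

Lemma card_neq0 : q != 0.
Proof. by rewrite pnatr_eq0 -lt0n; apply/card_gt0P; exists 0. Qed.

Lemma sum_psi r : \sum_x psi (x * r) = q * (r == 0)%:R.
Proof.
have [->|r0] := eqVneq r 0.
  rewrite (eq_bigr (fun=> 1)) => [|x _]; last by rewrite mulr0.
  by rewrite sumr_const mulr1.
rewrite mulr0; under eq_bigr do rewrite mulrC; rewrite sum_scale //.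
have [y y1] := psi_neq1.
have E : psi y * \sum_x psi x = \sum_x psi x.
  by rewrite mulr_sumr -[RHS](sum_translate psi y); apply: eq_bigr => x _; rewrite psiD mulrC.
have /eqP : (psi y - 1) * \sum_x psi x = 0 by rewrite mulrBl E mul1r subrr.
by rewrite mulf_eq0 subr_eq0 (negPf y1) => /eqP.
Qed.

Lemma gaussE f : f 0 = 0 -> g f = - \sum_x psi x * f x.
Proof. by move=> f0; rewrite /gauss sum_neq0 f0 mulr0 subr0. Qed.

Lemma gauss_eps : g (@eps F) = 1.
Proof.
rewrite /gauss (eq_bigr psi) => [|x x0]; last by rewrite eps_neq0 // mulr1.
have E : \sum_x psi x = 0.
  by have := sum_psi 1; rewrite oner_eq0 mulr0 => S0;
    rewrite -[RHS]S0; apply: eq_bigr => x _; rewrite mulr1.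
by rewrite sum_neq0 E psi0 sub0r opprK.
Qed.

Lemma sum_psi_scale f r : is_mchar f -> r != 0 ->
  \sum_x psi (x * r) * f x = - (f r)^-1 * g f.
Proof.
move=> fP r0; have [f0 _ fM] := fP.
rewrite gaussE // mulrNN -[in RHS](sum_scale _ r0) mulr_sumr; apply: eq_bigr => x _.
by rewrite fM [r * x]mulrC mulrCA [(f r)^-1 * _]mulKf // is_mchar_neq0.
Qed.

Lemma mulf_fconj f x : is_mchar f -> f x * fconj f x = eps x.
Proof.
move=> fP; rewrite /eps /fconj; have [->|x0] := eqVneq x 0.
  by have [-> _ _] := fP; rewrite mul0r.
by rewrite divff // is_mchar_neq0.
Qed.

Lemma fmul_fconj f : is_mchar f -> fmul f (fconj f) = @eps F.
Proof. by move=> fP; apply: functional_extensionality => x; apply: mulf_fconj. Qed.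

(** In the double sum put [x * t] for the variable of [f]: the characters of [x] cancel and additive
    orthogonality in [x] selects [t = -1]. *)
Lemma gauss_fconj f : is_mchar f -> f <> @eps F -> g f * g (fconj f) = f (-1) * q.
Proof.
move=> fP fne; have [f0 f1 fM] := fP; have [h0 h1 hM] := is_mchar_fconj fP.
rewrite !gaussE // mulrNN mulrC mulr_suml.
transitivity (\sum_x \sum_t psi (x * (1 + t)) * (fconj f x * f x * f t)).
  apply: eq_bigr => x _; rewrite mulr_sumr.
  have [->|x0] := eqVneq x 0.
    by rewrite !big1 // => t _; rewrite h0 !(mulr0, mul0r).
  rewrite -(sum_scale _ x0); apply: eq_bigr => t _.
  by rewrite mulrDr mulr1 psiD fM; ring.
rewrite exchange_big /=.
(* The sum over [x] omits [x = 0], whence the [- 1]; its contribution is the sum of the non-trivial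
   [f], which is zero. *)
transitivity (\sum_t (q * (1 + t == 0)%:R - 1) * f t).
  apply: eq_bigr => t _; rewrite -sum_psi.
  under eq_bigr do rewrite mulrA; rewrite -mulr_suml; congr (_ * f t).
  rewrite [RHS](_ : _ = \sum_(x | x != 0) psi (x * (1 + t))); last first.
    by rewrite sum_neq0 mul0r psi0.
  rewrite [RHS]big_mkcond; apply: eq_bigr => x _.
  by rewrite [fconj f x * _]mulrC mulf_fconj // /eps; case: ifP; rewrite ?mulr1 ?mulr0.
under eq_bigr do rewrite mulrBl mul1r.
rewrite sumrB (sum_is_mchar fP) delta_neq // mulr0 subr0 (bigD1 (-1)) //= subrr eqxx mulr1.
rewrite big1 ?addr0 ?[q * _]mulrC // => t t1.
by rewrite addrC addr_eq0 (negPf t1) mulr0 mul0r.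
Qed.

Lemma gauss_neq0 f : is_mchar f -> g f != 0.
Proof.
move=> fP; have [/deltaP->|/deltaP fne] := boolP (delta f == 1%N).
  by rewrite gauss_eps oner_eq0.
have := gauss_fconj fP fne; apply: contra_eq_neq => ->.
by rewrite mul0r eq_sym mulf_neq0 ?card_neq0 // is_mchar_neq0 // oppr_eq0 oner_eq0.
Qed.

Lemma gaussc_neq0 f : is_mchar f -> gc f != 0.
Proof. by move=> fP; rewrite /gaussc mulf_neq0 ?expf_neq0 ?card_neq0 ?gauss_neq0. Qed.

Lemma gaussc_eps : gc (@eps F) = q.
Proof. by rewrite /gaussc delta_eps gauss_eps mulr1. Qed.

Lemma gaussc_neq f : f <> @eps F -> gc f = g f.
Proof. by move=> fne; rewrite /gaussc delta_neq // mul1r. Qed.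

Lemma mchar_m1_sqr f : is_mchar f -> f (-1) * f (-1) = 1.
Proof. by move=> [_ f1 fM]; rewrite -fM mulrNN mulr1. Qed.

Lemma fconj_eps : fconj (@eps F) = @eps F.
Proof.
apply: functional_extensionality => x; rewrite /fconj /eps.
by case: ifP; rewrite ?invr1 ?invr0.
Qed.

(** The power of [q] in [gaussc] makes the reflection formula hold for the trivial character too. *)
Lemma gaussc_fconj f : is_mchar f -> gc f * g (fconj f) = f (-1) * q.
Proof.
move=> fP; have [/deltaP->|/deltaP fne] := boolP (delta f == 1%N).
  by rewrite fconj_eps gaussc_eps gauss_eps eps_neq0 ?mulr1 ?mul1r // oppr_eq0 oner_eq0.
by rewrite gaussc_neq // gauss_fconj.
Qed.

(** Serves to turn the denominators of hypergeometric coefficients into Gauss sums, which can be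
    expanded. *)
Lemma gaussc_inv f : is_mchar f -> (gc f)^-1 = f (-1) * g (fconj f) / q.
Proof.
move=> fP; apply: (mulfI (gaussc_neq0 fP)); rewrite divff ?gaussc_neq0 //.
rewrite mulrA mulrCA gaussc_fconj // mulrA mchar_m1_sqr // mul1r divff //.
exact: card_neq0.
Qed.

(** The product of Gauss sums is sorted by the sum [s] of the two variables. Each [s <> 0] yields
    the Jacobi sum by scaling; [s = 0] contributes only when [f * h] is trivial, and [gaussc]
    accounts for this. *)
Lemma jacobi f h : is_mchar f -> is_mchar h -> f <> @eps F ->
  gc (fmul f h) * - (\sum_t f t * h (1 - t)) = g f * g h.
Proof.
move=> fP hP fne; have [f0 f1 fM] := fP; have [h0 h1 hM] := hP.
have fhP := is_mchar_fmul fP hP; have [k0 k1 kM] := fhP.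
set J := \sum_t _.
have E : g f * g h = - g (fmul f h) * J + h (-1) * ((q - 1) * (delta (fmul f h))%:R).
  rewrite !gaussE // mulrNN opprK mulr_suml -sum_is_mchar //.
  transitivity (\sum_x \sum_s psi s * (f x * h (s - x))).
    apply: eq_bigr => x _; rewrite mulr_sumr -(sum_translate _ (- x)).
    by apply: eq_bigr => s _; rewrite mulrACA -psiD [x + _]addrC subrK.
  rewrite exchange_big (bigD1 0) //= addrC mulr_suml [X in _ = X + _](bigD1 0) //=.
  rewrite k0 mulr0 mul0r add0r mulr_sumr; congr (_ + _).
    apply: eq_bigr => s s0; rewrite -(sum_scale _ s0) /J !mulr_sumr.
    apply: eq_bigr => t _; rewrite fM (_ : s - s * t = s * (1 - t)) ?hM /fmul; ring.
  apply: eq_bigr => x _; rewrite psi0 mul1r sub0r -[- x]mulN1r [in LHS]hM /fmul; ring.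
(* In the case of trivial [f * h], [h] is the inverse of [f], and the reflection formula inserted in
   [E] forces [J = - f (-1)]. *)
have [/eqP d1|/deltaP kne] := boolP (delta (fmul f h) == 1%N); last first.
  by rewrite E gaussc_neq // delta_neq // !mulr0 addr0; ring.
have hE : h = fconj f.
  apply: functional_extensionality => x; rewrite /fconj.
  have /eqP/deltaP/(congr1 (@^~ x)) := d1; rewrite /fmul -(mulf_fconj x fP).
  have [->|x0] := eqVneq x 0; first by rewrite h0 f0 invr0.
  exact/mulfI/is_mchar_neq0.
have fhE : fmul f h = @eps F by rewrite hE fmul_fconj.
move: E; rewrite d1 mulr1 fhE gauss_eps gaussc_eps mulN1r.
have -> : h (-1) = f (-1) by rewrite hE /fconj -is_mcharV // invrN invr1.
rewrite hE gauss_fconj // => E2; have -> : J = - f (-1); last by ring.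
by apply: (addIr (f (-1) * q)); rewrite {1}E2; ring.
Qed.

End GaussSums.

(** * Kloosterman sums, their Mellin transforms and hypergeometric series *)

Section KloostermanSums.
Variables (F : finFieldType) (psi : F -> algC).
Hypothesis psiD : {morph psi : x y / x + y >-> x * y}.
Hypothesis psi0 : psi 0 = 1.
Hypothesis psi_neq1 : exists x, psi x != 1.
Implicit Types (f h A B C X : F -> algC) (x y z w k r s t u v : F).
Local Notation q := (#|F|%:R : algC).
Local Notation g := (gauss psi).
Local Notation gc := (gaussc psi).

(* The finite field analogue of a Bessel function. *)
Definition kloo C w := \sum_t C t * psi (t + w / t).

Lemma kloo0 C : is_mchar C -> kloo C 0 = - g C.
Proof.
move=> [C0 _ _]; rewrite gaussE // opprK; apply: eq_bigr => t _.
by rewrite mul0r addr0 mulrC.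
Qed.

(** The Mellin transform of [kloo C]: put [w = s * t], where [s] and [t] are the variables of the
    two Gauss sums. *)
Lemma gauss_mul_kloo X C : is_mchar X -> is_mchar C ->
  g X * g (fmul X C) = \sum_w X w * kloo C w.
Proof.
move=> XP CP; have [X0 X1 XM] := XP; have [C0 _ _] := CP.
have [Y0 _ _] := is_mchar_fmul XP CP.
rewrite !gaussE // mulrNN mulrC mulr_suml.
rewrite [RHS](eq_bigr (fun w => \sum_t X w * (C t * psi (t + w / t)))); last first.
  by move=> w _; rewrite mulr_sumr.
rewrite exchange_big; apply: eq_bigr => t _.
have [->|t0] := eqVneq t 0.
  by rewrite Y0 mulr0 mul0r big1 // => w _; rewrite C0 mul0r mulr0.
rewrite mulr_sumr -[RHS](sum_scale _ t0); apply: eq_bigr => s _.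
by rewrite XM psiD [t * s / t]mulrAC divff // mul1r /fmul; ring.
Qed.

(** Here [k = t * r]; the terms with [t = 0] vanish because [C 0 = 0]. *)
Lemma sum_mchar_conv C (G : F -> F -> algC) : is_mchar C ->
  \sum_t \sum_r C t * C r * G t r =
  \sum_k C k * \sum_(t | t != 0) G t (k / t).
Proof.
move=> [C0 _ CM].
rewrite [RHS](eq_bigr (fun k => \sum_(t | t != 0) C k * G t (k / t))); last first.
  by move=> k _; rewrite mulr_sumr.
rewrite [RHS]exchange_big (bigD1 0) //= [X in X + _]big1 => [|r _].
  rewrite add0r; apply: eq_bigr => t t0; rewrite -[RHS](sum_scale _ t0); apply: eq_bigr => r _.
  by rewrite CM [t * r / t]mulrAC divff // mul1r.
by rewrite C0 !mul0r.
Qed.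

(** For [x <> 0] this is a rescaling of [t]; for [x = 0 <> y] both sides are complete additive sums
    without the term at 0. At [x = y = 0] it fails: the sides are [q - 1] and [-1]. *)
Lemma sum_psi_inv x y : (x != 0) || (y != 0) ->
  \sum_(t | t != 0) psi (x * t + y / t) = \sum_(t | t != 0) psi (t + x * y / t).
Proof.
rewrite !sum_neq0 !invr0 !mulr0 !addr0; have [->/= y0|x0 _] := eqVneq x 0; last first.
  rewrite -[in RHS](sum_scale _ x0); congr (_ - _); apply: eq_bigr => t _.
  by rewrite invfM mulrACA divff // mul1r.
congr (_ - _); rewrite -[LHS]sum_inv.
transitivity (\sum_t psi (t * y)).
  by apply: eq_bigr => t _; rewrite invrK mul0r add0r mulrC.
transitivity (\sum_t psi (t * 1)); last by apply: eq_bigr => t _; rewrite !mul0r addr0 mulr1.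
by rewrite !sum_psi // (negPf y0) oner_eq0.
Qed.

(* Sorting both sides by the value [k] of the product of the two variables
   leaves sums of [psi (x * t + y / t)], which depend on [x * y] only. *)
Lemma kloo_mul C w y : is_mchar C -> w != 0 -> y != 0 -> y ^+ 2 != 1 ->
  kloo C w * kloo C (w * y ^+ 2) =
  \sum_s C s * psi (s + w * (1 + y ^+ 2) / s) * kloo C ((w * y / s) ^+ 2).
Proof.
move=> CP w0 y0 y1.
transitivity (\sum_t \sum_r C t * C r * psi (t + w / t + (r + w * y ^+ 2 / r))).
  rewrite /kloo mulr_suml; apply: eq_bigr => t _; rewrite mulr_sumr.
  by apply: eq_bigr => r _; rewrite mulrACA -psiD.
transitivity (\sum_s \sum_r C s * C r *
    psi (s + w * (1 + y ^+ 2) / s + (r + (w * y / s) ^+ 2 / r))); last first.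
  apply: eq_bigr => s _; rewrite mulr_sumr.
  by apply: eq_bigr => r _; rewrite mulrACA -psiD.
rewrite !sum_mchar_conv //; apply: eq_bigr => k _.
have [->|k0] := eqVneq k 0; first by have [-> _ _] := CP; rewrite !mul0r.
(* With the second variable equal to [k / t], the exponents are [c * t + (w + k) / t] on the left
   and [t + c * (w + k) / t] on the right. *)
congr (_ * _); pose c := 1 + w * y ^+ 2 / k.
transitivity (\sum_(t | t != 0) psi (c * t + (w + k) / t)).
  by apply: eq_bigr => t t0; rewrite /c; congr psi; field; rewrite t0.
rewrite sum_psi_inv.
  by apply: eq_bigr => t t0; rewrite /c; congr psi; field; rewrite t0.
(* If both coefficients vanished, then [k = - w], and [c = 0] would give [y ^+ 2 = 1]. *)
rewrite -negb_and; apply: contra y1 => /andP[c0 /eqP wk].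
have kE : k = - w by apply/eqP; rewrite -addr_eq0 addrC wk.
move: c0; rewrite /c kE invrN mulrN [w * _]mulrC mulfK // subr_eq0 eq_sym.
by [].
Qed.

(* The normalized binomial series evaluated at [1 - w]; it is [A^-1 w] except
   for a jump at [w = 0] when [A] is trivial. *)
Definition gbinom A w := (A w)^-1 + (1 - q) * (delta A)%:R * (w == 0)%:R.

(** Scaling [v] gives the case [w <> 0]. At [w = 0] the sum is [kloo C 0] times the sum of [A],
    which is the jump term of [gbinom]. *)
Lemma sum_kloo_scale A C w : is_mchar A -> is_mchar C ->
  \sum_v A v * kloo C (v * w) = g A * g (fmul A C) * gbinom A w.
Proof.
move=> AP CP; have [A0 A1 AM] := AP; rewrite /gbinom.
have [->|w0] := eqVneq w 0; last first.
  rewrite mulr0 addr0 gauss_mul_kloo // -[LHS](sum_scale _ (invr_neq0 w0)) mulr_suml.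
  by apply: eq_bigr => v _; rewrite AM is_mcharV // [w^-1 * v * w]mulrAC mulVf // mul1r; ring.
under eq_bigr do rewrite mulr0.
rewrite -mulr_suml kloo0 // sum_is_mchar // A0 invr0.
have [/eqP d1|/deltaP/delta_neq->] := boolP (delta A == 1%N); last first.
  by rewrite !(mulr0, mul0r, addr0).
have /eqP/deltaP AE := d1.
by rewrite d1 AE gauss_eps // eps_fmul // -[true%:R]/1 !mulr1; ring.
Qed.

Lemma gbinomM A x w : is_mchar A -> x != 0 ->
  gbinom A (w / x) = A x * gbinom A w.
Proof.
move=> AP x0; have [A0 A1 AM] := AP; rewrite /gbinom.
rewrite AM is_mcharV // invfM invrK mulf_eq0 invr_eq0 (negPf x0) orbF.
have [->|w0] := eqVneq w 0; last by rewrite !mulr0 !addr0 mulrC.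
rewrite A0 invr0 mul0r !add0r.
have [/deltaP->|/deltaP/delta_neq->] := boolP (delta A == 1%N); last first.
  by rewrite !(mulr0, mul0r).
by rewrite eps_neq0 // mul1r.
Qed.

Lemma fconj_fmul f h : fconj (fmul f h) = fmul (fconj f) (fconj h).
Proof. by apply: functional_extensionality => x; rewrite /fconj /fmul invfM. Qed.

Lemma fconjK f : fconj (fconj f) = f.
Proof. by apply: functional_extensionality => x; rewrite /fconj invrK. Qed.

Lemma fmulA f h A : fmul f (fmul h A) = fmul (fmul f h) A.
Proof. by apply: functional_extensionality => x; rewrite /fmul mulrA. Qed.

Lemma fmulC f h : fmul f h = fmul h f.
Proof. by apply: functional_extensionality => x; rewrite /fmul mulrC. Qed.

Lemma pochcV f h : (pochc psi f h)^-1 = gc f * (gc (fmul f h))^-1.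
Proof. by rewrite /pochc invf_div. Qed.

(** The finite binomial theorem: after expanding the Gauss sums over [s] and [t], orthogonality
    forces [t = - w * s], which leaves a Gauss sum for [A] at frequency [1 - w]. *)
Lemma poch_binomial A w : is_mchar A -> w != 0 ->
  \sum_(i : Iirr (UG F)) poch psi A (mchar i) / pochc psi (@eps F) (mchar i) * mchar i w
  = (1 - q) * gbinom A (1 - w).
Proof.
move=> AP w0; have [A0 A1 AM] := AP; have q0 := card_neq0 F.
have gA0 := gauss_neq0 psiD psi0 psi_neq1 AP.
transitivity ((g A)^-1 * \sum_i \sum_s \sum_t
    psi s * A s * psi t * mchar i (- w * s / t)).
  rewrite mulr_sumr; apply: eq_bigr => i _; have mP := is_mchar_mchar i.
  have [m0 m1 mM] := mP.
  rewrite /poch /pochc eps_fmul // gaussc_eps // invfM invrK gaussc_inv //.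
  rewrite [g (fmul _ _)]gaussE ?[g (fconj _)]gaussE /fmul ?A0 ?mul0r //; last first.
    by rewrite /fconj m0 invr0.
  transitivity ((g A)^-1 * ((\sum_s psi s * (A s * mchar i s)) *
    (\sum_t psi t * fconj (mchar i) t) * mchar i (- w))); last first.
    congr (_ * _); rewrite mulr_suml mulr_suml; apply: eq_bigr => s _.
    rewrite mulr_sumr mulr_suml; apply: eq_bigr => t _.
    by rewrite !mM is_mcharV // /fconj; ring.
  by rewrite -[- w]mulN1r mM; field; rewrite ?q0 ?gA0.
transitivity ((g A)^-1 * \sum_s \sum_t psi s * A s * psi t *
    ((q - 1) * (- w * s / t == 1)%:R)).
  congr (_ * _); rewrite exchange_big; apply: eq_bigr => s _.
  rewrite exchange_big; apply: eq_bigr => t _.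
  by rewrite -mulr_sumr sum_mchar.
transitivity ((g A)^-1 * ((q - 1) * \sum_s psi (s * (1 - w)) * A s)).
  congr (_ * _); rewrite mulr_sumr; apply: eq_bigr => s _.
  have [->|s0] := eqVneq s 0; first by rewrite A0 !mulr0 big1 // => t _; rewrite !mul0r.
  rewrite (bigD1 (- w * s)) //= divff ?mulf_neq0 ?oppr_eq0 // eqxx -[true%:R]/1 big1 ?addr0.
    by rewrite (_ : s * (1 - w) = s + - w * s) ?psiD; ring.
  move=> t tws; have [->|t0] := eqVneq t 0.
    by rewrite invr0 mulr0 eq_sym oner_eq0 !mulr0.
  by rewrite -(divff t0) (inj_eq (mulIf (invr_neq0 t0))) eq_sym (negPf tws) !mulr0.
(* At [w = 1] the frequency is zero and the sum of [A] itself remains: this is the source of the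
   jump. *)
rewrite /gbinom; have [w1|w1] := eqVneq (1 - w) 0; last first.
  by rewrite sum_psi_scale // mulr0 addr0; field; rewrite gA0 is_mchar_neq0.
rewrite w1 A0 invr0 add0r mulr1.
under eq_bigr do rewrite mulr0 psi0 mul1r.
rewrite sum_is_mchar //.
have [/eqP d1|/deltaP/delta_neq->] := boolP (delta A == 1%N); last by rewrite !mulr0.
have /eqP/deltaP AE := d1.
by rewrite d1 AE gauss_eps // invr1 -[true%:R]/1 !mulr1; ring.
Qed.

(** Parseval for the Mellin transform: the two pairs of Gauss sums are transforms of [kloo C] in [w]
    and [r], and the sum over the characters forces [r = w * v]. *)
Lemma sum_gauss4 A C v : is_mchar A -> is_mchar C -> v != 0 ->
  \sum_(i : Iirr (UG F)) g (fmul A (mchar i)) * g (fmul (fmul A (mchar i)) C) *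
    (g (fconj (mchar i)) * g (fmul (fconj (mchar i)) C)) * mchar i v
  = (q - 1) * \sum_w A w * kloo C w * kloo C (w * v).
Proof.
move=> AP CP v0; have [A0 A1 AM] := AP.
transitivity (\sum_(i : Iirr (UG F)) \sum_w \sum_r
    A w * kloo C w * kloo C r * mchar i (w * v / r)).
  apply: eq_bigr => i _; have mP := is_mchar_mchar i; have [m0 m1 mM] := mP.
  rewrite !gauss_mul_kloo //; [|exact: is_mchar_fconj|exact: is_mchar_fmul].
  rewrite mulr_suml mulr_suml; apply: eq_bigr => w _.
  rewrite mulr_sumr mulr_suml; apply: eq_bigr => r _.
  by rewrite !mM is_mcharV // /fconj /fmul; ring.
rewrite exchange_big mulr_sumr; apply: eq_bigr => w _.
have [->|w0] := eqVneq w 0.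
  by rewrite A0 !mul0r mulr0 big1 // => i _; rewrite big1 // => r _; rewrite !mul0r.
rewrite exchange_big /= (bigD1 (w * v)) //= -mulr_sumr sum_mchar divff ?mulf_neq0 //.
rewrite eqxx -[true%:R]/1 big1 ?addr0; first by ring.
move=> r rwv; rewrite -mulr_sumr sum_mchar.
have [->|r0] := eqVneq r 0; first by rewrite invr0 mulr0 eq_sym oner_eq0 !mulr0.
by rewrite -(divff r0) (inj_eq (mulIf (invr_neq0 r0))) eq_sym (negPf rwv) !mulr0.
Qed.

Lemma sum_poch_kloo A C v : is_mchar A -> is_mchar C -> v != 0 ->
  \sum_(i : Iirr (UG F)) poch psi A (mchar i) * poch psi (fmul A C) (mchar i) /
    (pochc psi (fconj C) (mchar i) * pochc psi (@eps F) (mchar i)) * mchar i v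
  = (q - 1) / (g A * g (fmul A C) * g C) * \sum_w A w * kloo C w * kloo C (w * v).
Proof.
move=> AP CP v0; have ACP := is_mchar_fmul AP CP; have DP := is_mchar_fconj CP.
have q0 := card_neq0 F.
have gA0 := gauss_neq0 psiD psi0 psi_neq1 AP.
have gAC0 := gauss_neq0 psiD psi0 psi_neq1 ACP.
have gC0 := gauss_neq0 psiD psi0 psi_neq1 CP.
have gcD : gc (fconj C) = fconj C (-1) * q / g C.
  by rewrite -(gaussc_fconj psiD psi0 psi_neq1 DP) fconjK mulfK.
rewrite [_ / _ * _]mulrAC -sum_gauss4 // mulr_suml; apply: eq_bigr => i _.
have mP := is_mchar_mchar i; have [m0 m1 mM] := mP; have DmP := is_mchar_fmul DP mP.
rewrite [(pochc _ _ _ * _)^-1]invfM /poch !pochcV eps_fmul // gaussc_eps //.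
rewrite (gaussc_inv psiD psi0 psi_neq1 DmP) (gaussc_inv psiD psi0 psi_neq1 mP).
rewrite fconj_fmul fconjK gcD [fmul C _]fmulC -fmulA [fmul C _]fmulC fmulA.
rewrite -[fmul (fconj C) _ _]/(fconj C (-1) * mchar i (-1)).
have D2 := mchar_m1_sqr DP; have M2 := mchar_m1_sqr mP.
move: D2 M2; move: (fconj C (-1)) (mchar i (-1)) => d e D2 M2.
(* The signs [d] and [e], values of characters at [-1] produced by the reflection formula, each
   occur squared. *)
transitivity (g (fmul A (mchar i)) * g (fmul (fmul A (mchar i)) C) *
 (g (fconj (mchar i)) * g (fmul (fconj (mchar i)) C)) * mchar i v /
 (g A * g (fmul A C) * g C) * (d * d) * (e * e)).
  by field; rewrite gC0 gAC0 gA0 q0.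
by rewrite D2 M2 !mulr1.
Qed.

End KloostermanSums.

(** * The Gegenbauer product formula and the quadratic transformation of 2F1 *)

Section QuadraticTransformation.
Variables (F : finFieldType) (psi : F -> algC).
Hypothesis char_neq2 : ~~ (2%N \in [pchar F]).
Hypothesis psiD : {morph psi : x y / x + y >-> x * y}.
Hypothesis psi0 : psi 0 = 1.
Hypothesis psi_neq1 : exists x, psi x != 1.
Implicit Types (A B C : F -> algC) (x y z w r t u v : F).
Local Notation q := (#|F|%:R : algC).
Local Notation g := (gauss psi).
Local Notation gc := (gaussc psi).
Local Notation phi := (@qchar F).
Local Notation kloo := (kloo psi).

Lemma qcharV x : (phi x)^-1 = phi x.
Proof. by rewrite /qchar; case: ifP => _; last case: ifP => _; rewrite ?invr0 ?invr1 ?invrN1. Qed.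

(** By [sum_sqr] the weight is [1 + phi v]; the part with weight 1 vanishes as [r <> 0], and the
    other is a Gauss sum of [phi]. *)
Lemma sum_gauss_quadratic r : r != 0 ->
  \sum_u psi (- r * u ^+ 2) = - phi (- r) * g phi.
Proof.
move=> r0; rewrite (sum_sqr char_neq2 (fun v => psi (- r * v))).
under eq_bigr do rewrite mulrDl mul1r.
rewrite big_split /=; under eq_bigr do rewrite mulrC.
rewrite sum_psi // oppr_eq0 (negPf r0) mulr0 add0r.
under eq_bigr do rewrite mulrC [- r * _]mulrC.
by rewrite sum_psi_scale ?oppr_eq0 ?qcharV //; apply: is_mchar_qchar.
Qed.

(* [B (1 - u^2)] is expanded as a Gauss sum over [r]; completing the square
   then turns the sum over [u] into a quadratic Gauss sum. *)
Lemma kloo_poisson B : is_mchar B -> B <> @eps F -> exists2 l, l != 0 &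
  forall z, \sum_u B (1 - u ^+ 2) * psi (2%:R * u * z) =
            l * kloo (fmul (fconj B) phi) (z ^+ 2).
Proof.
move=> BP Bne; have [B0 B1 BM] := BP; have BbP := is_mchar_fconj BP.
have phiP := is_mchar_qchar char_neq2; have [_ _ phiM] := phiP.
have gB0 := gauss_neq0 psiD psi0 psi_neq1 BbP.
(* The denominator comes from expanding [B], the numerator from the quadratic Gauss sum, with
   [phi (- r)] split as [phi (-1) * phi r]. *)
exists (phi (-1) * g phi / g (fconj B)) => [|z].
  rewrite !mulf_neq0 ?invr_neq0 ?gauss_neq0 // is_mchar_neq0 //.
  by rewrite oppr_eq0 oner_eq0.
apply: (mulfI gB0); rewrite mulrA mulrCA divff // mulr1 !mulr_sumr.
(* This holds at [v = 0] as well, since [B] is non-trivial and the sum of its inverse is zero. *)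
have BE v : g (fconj B) * B v = - \sum_r psi (r * v) * fconj B r.
  have [->|v0] := eqVneq v 0; last first.
    by rewrite sum_psi_scale // /fconj invrK; ring.
  under eq_bigr do rewrite mulr0 psi0 mul1r.
  rewrite B0 sum_is_mchar // delta_neq ?mulr0 ?oppr0 // => Be.
  by apply: Bne; rewrite -[B]fconjK Be fconj_eps.
transitivity (\sum_u \sum_r - (fconj B r * psi (r + z ^+ 2 / r)) *
    psi (- r * (u - z / r) ^+ 2)).
  apply: eq_bigr => u _; rewrite mulrA BE mulNr mulr_suml -sumrN; apply: eq_bigr => r _.
  have [->|r0] := eqVneq r 0.
    by have [-> _ _] := BbP; rewrite !(mulr0, mul0r, oppr0).
  rewrite mulNr; congr (- _); rewrite -[RHS]mulrA -psiD mulrAC -psiD mulrC; congr (_ * psi _).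
  by field; rewrite r0.
rewrite exchange_big; apply: eq_bigr => r _.
have [->|r0] := eqVneq r 0.
  rewrite big1 => [|u _].
    by rewrite /fmul; have [-> _ _] := BbP; rewrite !(mul0r, mulr0).
  by have [-> _ _] := BbP; rewrite !(mulr0, mul0r, oppr0).
rewrite -mulr_sumr (sum_translate (fun u => psi (- r * u ^+ 2))).
by rewrite sum_gauss_quadratic // -[- r]mulN1r phiM /fmul; ring.
Qed.

(* The product formula of Gegenbauer for Bessel functions. *)
Lemma kloo_gegenbauer B y : is_mchar B -> B <> @eps F ->
  y != 0 -> y ^+ 2 != 1 -> exists2 l, l != 0 &
  \sum_u B (1 - u ^+ 2) = - (l * g (fmul (fconj B) phi)) /\
  forall w, w != 0 ->
    l * (kloo (fmul (fconj B) phi) w * kloo (fmul (fconj B) phi) (w * y ^+ 2)) =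
    \sum_u B (1 - u ^+ 2) *
      kloo (fmul (fconj B) phi) (w * (1 + y ^+ 2 + 2%:R * u * y)).
Proof.
move=> BP Bne y0 y1; have phiP := is_mchar_qchar char_neq2.
have CP := is_mchar_fmul (is_mchar_fconj BP) phiP.
have [l l0 lE] := kloo_poisson BP Bne; exists l => //; split=> [|w w0].
  have := lE 0; rewrite expr0n kloo0 // mulrN => <-.
  by apply: eq_bigr => u _; rewrite mulr0 psi0 mulr1.
(* Each [kloo] factor at [(w * y / s) ^+ 2] is replaced by its Poisson integral with
   [z = w * y / s]; exchanging the sums then restores a Kloosterman sum in [s]. *)
rewrite kloo_mul // mulr_sumr.
transitivity (\sum_s \sum_u B (1 - u ^+ 2) * (fmul (fconj B) phi s *
    psi (s + w * (1 + y ^+ 2 + 2%:R * u * y) / s))).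
  apply: eq_bigr => s _; rewrite mulrCA -lE mulr_sumr; apply: eq_bigr => u _.
  rewrite mulrCA; congr (_ * _); rewrite -[LHS]mulrA -psiD; congr (_ * psi _).
  have [->|s0] := eqVneq s 0; first by rewrite invr0 !mulr0 !addr0.
  by field; rewrite s0.
by rewrite exchange_big; apply: eq_bigr => u _; rewrite /kloo mulr_sumr.
Qed.

(** Substitute [u = 2 t - 1], for which [1 - u ^ 2 = 4 t (1 - t)]. *)
Lemma sum_jacobi_sqr B (G : F -> algC) : is_mchar B ->
  \sum_u B (1 - u ^+ 2) * G u =
  B 4%:R * \sum_t B t * B (1 - t) * G (2%:R * t - 1).
Proof.
move=> [_ _ BM]; have n2 := two_neq0 char_neq2.
rewrite -[LHS](sum_translate _ (-1)) -[LHS](sum_scale _ n2) mulr_sumr.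
apply: eq_bigr => t _; rewrite !mulrA -!BM; congr (B _ * _); ring.
Qed.

(** Euler's integral: the quotient of the symbols of [B] and [B * B] is a Jacobi sum in [t], and the
    remaining series is binomial in [(1 - t) * z]. *)
Lemma poch_jacobi B z A : is_mchar A -> is_mchar B -> B <> @eps F -> z != 0 ->
  \sum_(i : Iirr (UG F)) poch psi A (mchar i) * poch psi B (mchar i) /
    (pochc psi (fmul B B) (mchar i) * pochc psi (@eps F) (mchar i)) * mchar i z
  = (q - 1) * gc (fmul B B) / g B ^+ 2 *
    \sum_t B t * B (1 - t) * gbinom A (1 - (1 - t) * z).
Proof.
move=> AP BP Bne z0; have [B0 B1 BM] := BP; have BBP := is_mchar_fmul BP BP.
have gB0 := gauss_neq0 psiD psi0 psi_neq1 BP.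
have gBB0 := gaussc_neq0 psiD psi0 psi_neq1 BBP.
transitivity (- gc (fmul B B) / g B ^+ 2 * \sum_t \sum_(i : Iirr (UG F)) B t * B (1 - t) *
    (poch psi A (mchar i) / pochc psi (@eps F) (mchar i) * mchar i ((1 - t) * z))).
  rewrite exchange_big mulr_sumr; apply: eq_bigr => i _.
  have mP := is_mchar_mchar i; have [m0 m1 mM] := mP; have BmP := is_mchar_fmul BP mP.
  have BBmP := is_mchar_fmul BP BmP.
  have gBBm0 := gaussc_neq0 psiD psi0 psi_neq1 BBmP.
  have J := jacobi psiD psi0 psi_neq1 BP BmP Bne.
  have E : poch psi B (mchar i) / pochc psi (fmul B B) (mchar i) =
      - gc (fmul B B) / g B ^+ 2 * \sum_t B t * fmul B (mchar i) (1 - t).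
    rewrite pochcV -fmulA /poch; apply: (mulfI gBBm0); apply: (mulfI gB0).
    transitivity (g B * g (fmul B (mchar i)) * gc (fmul B B) / g B).
      by field; rewrite gB0 gBBm0.
    by rewrite -J; field; rewrite gB0.
  transitivity (poch psi B (mchar i) / pochc psi (fmul B B) (mchar i) *
     (poch psi A (mchar i) / pochc psi (@eps F) (mchar i) * mchar i z)).
    rewrite invfM; ring.
  rewrite E -[LHS]mulrA mulr_suml; congr (_ * _); apply: eq_bigr => t _.
  by rewrite mM /fmul; ring.
rewrite !mulr_sumr; apply: eq_bigr => t _.
rewrite -mulr_sumr; have [->|t1] := eqVneq (1 - t) 0; first by rewrite B0 !(mulr0, mul0r).
by rewrite poch_binomial ?mulf_neq0 //; ring.
Qed.

Lemma quadratic_transformation A B y :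
  is_mchar A -> is_mchar B -> fmul B B <> @eps F -> y != 1 -> y != -1 ->
  \sum_(i : Iirr (UG F)) poch psi A (mchar i) *
    poch psi (fmul (fmul A (fconj B)) phi) (mchar i) /
    (pochc psi (fmul B phi) (mchar i) * pochc psi (@eps F) (mchar i)) *
    mchar i (y ^+ 2)
  = (fconj A (1 + y)) ^+ 2 *
    \sum_(i : Iirr (UG F)) poch psi A (mchar i) * poch psi B (mchar i) /
    (pochc psi (fmul B B) (mchar i) * pochc psi (@eps F) (mchar i)) *
    mchar i (4%:R * y / (1 + y) ^+ 2).
Proof.
move=> AP BP BBne y1 ym1; have [->|y0] := eqVneq y 0.
  rewrite expr0n !mulr0 mul0r !big1 ?mulr0 // => i _;
    by have [-> _ _] := is_mchar_mchar i; rewrite mulr0.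
have [A0 A1 AM] := AP; have [B0 B1 BM] := BP.
have Bne : B <> @eps F by move=> Be; apply: BBne; rewrite Be eps_fmul //; apply: is_mchar_eps.
have yy1 : y ^+ 2 != 1 by rewrite sqrf_eq1 negb_or y1.
have y10 : 1 + y != 0 by rewrite addrC addr_eq0.
have n4 : 4%:R != 0 :> F by rewrite -[4%N]/(2 * 2)%N natrM mulf_neq0 // two_neq0.
have phiP := is_mchar_qchar char_neq2.
set C := fmul (fconj B) phi; have CP : is_mchar C.
  exact: is_mchar_fmul (is_mchar_fconj BP) phiP.
have ACP := is_mchar_fmul AP CP; have BBP := is_mchar_fmul BP BP.
have -> : fmul (fmul A (fconj B)) phi = fmul A C by rewrite -fmulA.
have -> : fmul B phi = fconj C.
  rewrite fconj_fmul fconjK; congr fmul.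
  by apply: functional_extensionality => x; rewrite /fconj qcharV.
rewrite sum_poch_kloo ?expf_neq0 // poch_jacobi ?mulf_neq0 ?invr_neq0 ?expf_neq0 //.
have [l l0 [lC lK]] := kloo_gegenbauer BP Bne y0 yy1; rewrite -/C in lC lK.
have gA0 := gauss_neq0 psiD psi0 psi_neq1 AP.
have gAC0 := gauss_neq0 psiD psi0 psi_neq1 ACP.
have gC0 := gauss_neq0 psiD psi0 psi_neq1 CP.
have gB0 := gauss_neq0 psiD psi0 psi_neq1 BP.
have gBB0 := gauss_neq0 psiD psi0 psi_neq1 BBP.
have B40 := is_mchar_neq0 BP n4.
(* The Mellin transform in [w] of the Gegenbauer formula; [w = 0] does not contribute because
   [A 0 = 0]. *)
have AE : \sum_w A w * kloo C w * kloo C (w * y ^+ 2) =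
    l^-1 * (g A * g (fmul A C) *
      \sum_u B (1 - u ^+ 2) * gbinom A (1 + y ^+ 2 + 2%:R * u * y)).
  apply: (mulfI l0); rewrite mulVKf // !mulr_sumr.
  transitivity (\sum_w \sum_u A w * (B (1 - u ^+ 2) *
      kloo C (w * (1 + y ^+ 2 + 2%:R * u * y)))).
    apply: eq_bigr => w _; have [->|w0] := eqVneq w 0.
      by rewrite A0 !mul0r mulr0 big1 // => u _; rewrite mul0r.
    by rewrite -mulr_sumr -lK //; ring.
  rewrite exchange_big; apply: eq_bigr => u _; rewrite mulrCA -sum_kloo_scale // mulr_sumr.
  by apply: eq_bigr => w _; rewrite mulrCA.
(* The constant [l] is found by computing the sum of [B (1 - u ^ 2)] twice: by [lC], and as a Jacobi
   sum, where [B * B] non-trivial gives [gaussc = gauss]. *)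
have LC : l * g C * g (fmul B B) = B 4%:R * g B ^+ 2.
  have J := jacobi psiD psi0 psi_neq1 BP BP Bne; rewrite gaussc_neq // in J.
  have := sum_jacobi_sqr (fun=> 1) BP.
  under eq_bigr do rewrite mulr1. under [in RHS]eq_bigr do rewrite mulr1.
  rewrite lC => E; rewrite expr2 -J -[l * _]opprK E; ring.
rewrite AE sum_jacobi_sqr // gaussc_neq //.
have -> : \sum_t B t * B (1 - t) * gbinom A (1 + y ^+ 2 + 2%:R * (2%:R * t - 1) * y) =
  (fconj A (1 + y)) ^+ 2 *
  \sum_t B t * B (1 - t) * gbinom A (1 - (1 - t) * (4%:R * y / (1 + y) ^+ 2)).
  rewrite mulr_sumr; apply: eq_bigr => t _.
  have -> : 1 - (1 - t) * (4%:R * y / (1 + y) ^+ 2) =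
      (1 + y ^+ 2 + 2%:R * (2%:R * t - 1) * y) / (1 + y) ^+ 2.
    by field; rewrite y10.
  rewrite gbinomM ?expf_neq0 // [A (_ ^+ 2)]AM /fconj.
  by field; rewrite is_mchar_neq0.
have -> : (q - 1) * g (fmul B B) / g B ^+ 2 = (q - 1) * B 4%:R / (l * g C).
  apply: (mulIf gC0); apply: (mulIf l0); apply: (mulIf (expf_neq0 2 gB0)).
  transitivity ((q - 1) * (l * g C * g (fmul B B))); first by field; rewrite gB0.
  by rewrite LC; field; rewrite l0 gC0.
by field; rewrite l0 gC0 gA0 gAC0.
Qed.

(** Used to split off the first character, so that the sum over the second is a one-variable series
    with [A * m] in place of [A]. *)
Lemma poch_fmul A m n : is_mchar A -> is_mchar m ->
  poch psi A (fmul m n) = poch psi A m * poch psi (fmul A m) n.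
Proof.
move=> AP mP; rewrite /poch fmulA.
by field; rewrite !gauss_neq0 //; apply: is_mchar_fmul.
Qed.

End QuadraticTransformation.

(** * Reduction of the Appell functions to one-variable series *)

Theorem theorem3p18 (F : finFieldType) (psi : F -> algC)
  (a b c : Iirr (UG F)) (x y : F) :
  ~~ (2%N \in [pchar F]) ->
  additive_char psi ->
  fmul (mchar b) (mchar b) <> eps (F:=F) ->
  y != 1 -> y != -1 ->
  appellF4 psi (mchar a) (fmul (fmul (mchar a) (fconj (mchar b))) (@qchar F))
    (mchar c) (fmul (mchar b) (@qchar F)) x (y ^+ 2)
  = (fconj (mchar a) (1 + y)) ^+ 2 *
    appellF2 psi (mchar a) (fmul (fmul (mchar a) (fconj (mchar b))) (@qchar F))
      (mchar b) (mchar c) (fmul (mchar b) (mchar b))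
      (x / (1 + y) ^+ 2) (4%:R * y / (1 + y) ^+ 2).
Proof.
move=> char2 [psiD psi_neq1] bb y1 ym1; rewrite /appellF4 /appellF2.
have aP := is_mchar_mchar a; have bP := is_mchar_mchar b.
have y10 : 1 + y != 0 by rewrite addrC addr_eq0.
have [psi00|psi0n] := eqVneq (psi 0) 0.
  (* [psi] vanishes identically, hence so do all Gauss sums. *)
  have g0 f : gauss psi f = 0.
    by rewrite /gauss big1 ?oppr0 // => z _; rewrite -[z]add0r psiD psi00 !mul0r.
  rewrite !big1 ?mulr0 // => i _; rewrite big1 // => j _;
    by rewrite /poch !g0 !mul0r.
have psi0 : psi 0 = 1 by apply: (mulIf psi0n); rewrite -psiD addr0 mul1r.
rewrite mulrCA; congr (_ * _); rewrite mulr_sumr; apply: eq_bigr => i _ /=.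
set B' := fmul (fmul _ _) _.
have iP := is_mchar_mchar i; have [_ _ iM] := iP; have aiP := is_mchar_fmul aP iP.
have B'P : is_mchar B'.
  exact/is_mchar_fmul/is_mchar_qchar/char2/is_mchar_fmul/is_mchar_fconj.
have B'iE :
    fmul B' (mchar i) = fmul (fmul (fmul (mchar a) (mchar i)) (fconj (mchar b))) (@qchar F).
  by apply: functional_extensionality => z; rewrite /B' /fmul; ring.
(* [T] collects the factors that depend on the first character only. *)
pose T := poch psi (mchar a) (mchar i) * poch psi B' (mchar i) /
  (pochc psi (mchar c) (mchar i) * pochc psi (@eps F) (mchar i)) * mchar i x.
transitivity (T * \sum_(j : Iirr (UG F)) poch psi (fmul (mchar a) (mchar i)) (mchar j) *
    poch psi (fmul B' (mchar i)) (mchar j) /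
    (pochc psi (fmul (mchar b) (@qchar F)) (mchar j) * pochc psi (@eps F) (mchar j)) *
    mchar j (y ^+ 2)).
  rewrite mulr_sumr; apply: eq_bigr => j _; rewrite !poch_fmul // /T !invfM.
  ring.
(* Applied with [a] times the first character: the extra factor, that character at [1 + y] to the
   power -2, moves into the argument [x / (1 + y) ^ 2]. *)
rewrite B'iE quadratic_transformation // mulrA !mulr_sumr; apply: eq_bigr => j _.
have -> : mchar i (x / (1 + y) ^+ 2) = mchar i x / mchar i (1 + y) ^+ 2.
  by rewrite iM is_mcharV // [mchar i (_ ^+ 2)]iM.
by rewrite poch_fmul // /T {1}/fconj /fmul !invfM /fconj; ring.
Qed.
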